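(* Let $\mathcal{H}=\mathbb{R}^d$ and let $k$ be the Gaussian kernel with parameter $\sigma>0$. Put $V=I_d+2\sigma\Sigma_0$ and $B(\underline{x})=(\underline{x}-\underline{m}_0)(\underline{x}-\underline{m}_0)^T-\Sigma_0$. Then for all $\underline{x},\underline{y}\in\mathbb{R}^d$, \begin{align*} \langle f(\underline{x}),f(\underline{y})\rangle_{H(k)} &=\exp\left(-\sigma\|\underline{x}-\underline{y}\|^2_{\mathbb{R}^d}\right)\\ &\quad-|V|^{-1/2}\exp\left(-\sigma(\underline{x}-\underline{m}_0)^TV^{-1}(\underline{x}-\underline{m}_0)\right)\Bigl\{1+2\sigma(\underline{x}-\underline{m}_0)^TV^{-1}(\underline{y}-\underline{m}_0)\\ &\qquad+\sigma\,\mathrm{tr}\left[V^{-1}\{2\sigma(B(\underline{x})+\Sigma_0)V^{-1}-I_d\}B(\underline{y})\right]\Bigr\}\\ &\quad-|V|^{-1/2}\exp\left(-\sigma(\underline{y}-\underline{m}_0)^TV^{-1}(\underline{y}-\underline{m}_0)\right)\Bigl\{1+2\sigma(\underline{y}-\underline{m}_0)^TV^{-1}(\underline{x}-\underline{m}_0)\\ &\qquad+\sigma\,\mathrm{tr}\left[V^{-1}\{2\sigma(B(\underline{y})+\Sigma_0)V^{-1}-I_d\}B(\underline{x})\right]\Bigr\}\\ &\quad+|2V-I_d|^{-1/2}\Bigl\{1+\sigma\,\mathrm{tr}\left[(2(\underline{x}-\underline{m}_0)(\underline{y}-\underline{m}_0)^T-B(\underline{x})-B(\underline{y}))(2V-I_d)^{-1}\right]\\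 &\qquad+\sigma^2\Bigl(\mathrm{tr}\left[B(\underline{x})(2V-I_d)^{-1}\right]\mathrm{tr}\left[B(\underline{y})(2V-I_d)^{-1}\right]\\ &\qquad\qquad+2\,\mathrm{tr}\left[B(\underline{x})(2V-I_d)^{-1}B(\underline{y})(2V-I_d)^{-1}\right]\Bigr)\Bigr\}. \end{align*}
   Context: The Gaussian kernel on $\mathbb{R}^d$ is $k(\underline{t},\underline{s})=\exp(-\sigma\|\underline{t}-\underline{s}\|^2_{\mathbb{R}^d})$, $\sigma>0$, with reproducing kernel Hilbert space $H(k)$. $\underline{m}_0\in\mathbb{R}^d$ and $\Sigma_0$ is a $d\times d$ covariance matrix (symmetric positive semidefinite). $|\cdot|$ denotes the determinant of a matrix. The kernel mean embedding of $N(\underline{m},\Sigma)$ is the function in $H(k)$ $$\mu(N(\underline{m},\Sigma))(\underline{z})=|I_d+2\sigma\Sigma|^{-1/2}\exp\left(-\sigma(\underline{z}-\underline{m})^T(I_d+2\sigma\Sigma)^{-1}(\underline{z}-\underline{m})\right).$$ For $\underline{x}\in\mathbb{R}^d$, $f(\underline{x})\in H(k)$ is $k(\cdot,\underline{x})-\mu(N(\underline{m}_0,\Sigma_0))$ minus the derivative of $(\underline{m},\Sigma)\mapsto\mu(N(\underline{m},\Sigma))$ at $(\underline{m}_0,\Sigma_0)$ applied to $(\underline{x}-\underline{m}_0,B(\underline{x}))$; explicitly, with $V=I_d+2\sigma\Sigma_0$, $$f(\underline{x})(\underline{z})=k(\underline{z},\underline{x})-\mu(N(\underline{m}_0,\Sigma_0))(\underline{z})\Bigl\{1+2\sigma(\underline{z}-\underline{m}_0)^TV^{-1}(\underline{x}-\underline{m}_0)+\sigma\,\mathrm{tr}\left[V^{-1}\{2\sigma(\underline{z}-\underline{m}_0)(\underline{z}-\underline{m}_0)^TV^{-1}-I_d\}B(\underline{x})\right]\Bigr\}.$$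 *)

(* Defs.v *)
From HB Require Import structures.
From mathcomp Require Import all_boot all_order all_algebra.
From mathcomp Require Import all_classical all_reals all_analysis.

Set Implicit Arguments.
Unset Strict Implicit.
Unset Printing Implicit Defensive.

Import Order.TTheory GRing.Theory Num.Theory.
Import numFieldNormedType.Exports.

Local Open Scope ring_scope.

(* A reproducing kernel Hilbert space of k is a Hilbert space whose elements
   are functions X -> R.  The carrier is an abstract complete normed space,
   identified with a space of functions through the injective linear map
   rkhs_eval; rkhs_section y is the element k(., y).  By the Moore-Aronszajn
   theorem a positive definite k has exactly one such space up to an isometry
   commuting with rkhs_eval. *)
Record rkhs (R : realType) (X : Type) (k : X -> X -> R) := Rkhs {
  rkhs_space :> completeNormedModType R;
  rkhs_dot : {dot rkhs_space for idfun};
  rkhs_eval : {linear rkhs_space -> (X -> R)};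
  rkhs_section : X -> rkhs_space;
  rkhs_normE : forall h, `|h| ^+ 2 = rkhs_dot h h;
  rkhs_eval_inj : injective rkhs_eval;
  rkhs_sectionE : forall x y, rkhs_eval (rkhs_section y) x = k x y;
  rkhs_reproducing : forall h x, rkhs_dot h (rkhs_section x) = rkhs_eval h x
}.

Section GaussianKernel.
Context (R : realType) (d : nat).
Implicit Types (sigma : R) (m u v x z : 'cV[R]_d) (A S : 'M[R]_d).

(* The squared Euclidean norm; `|u| on matrices is the sup norm. *)
Definition sqnorm2 u : R := \sum_(i < d) u i 0 ^+ 2.

Definition bform A u v : R := (u^T *m A *m v) 0 0.

Definition is_covariance S : Prop :=
  S^T = S /\ forall u, 0 <= bform S u u.

Definition gauss_kernel sigma x z : R := expR (- sigma * sqnorm2 (x - z)).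

Definition Vmx sigma S : 'M[R]_d := 1%:M + (2 * sigma) *: S.

(* The kernel mean embedding of N(m, S). *)
Definition gauss_embedding sigma m S z : R :=
  \det (Vmx sigma S) `^ (- 2^-1)
  * expR (- sigma * bform (invmx (Vmx sigma S)) (z - m) (z - m)).

Definition Bmx m S x : 'M[R]_d := (x - m) *m (x - m)^T - S.

(* z |-> k(z, x) - mu(N(m, S))(z) - D mu(N(m, S))(x - m, B(x))(z), with the
   derivative of the embedding in (m, S) written out. *)
Definition gauss_residual sigma m S x z : R :=
  let W := invmx (Vmx sigma S) in
  gauss_kernel sigma z x
  - gauss_embedding sigma m S z
    * (1 + 2 * sigma * bform W (z - m) (x - m)
       + sigma * \tr (W *m ((2 * sigma) *: ((z - m) *m (z - m)^T *m W) - 1%:M)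
                        *m Bmx m S x)).

End GaussianKernel.

(* Main.v *)
Require Import Defs.
From HB Require Import structures.
From mathcomp Require Import all_boot all_order all_algebra.
From mathcomp Require Import all_classical all_reals all_analysis.
From mathcomp Require Import measurable_realfun normal_distribution.
From mathcomp Require Import ring lra.
Import Order.TTheory GRing.Theory Num.Theory.
Import numFieldNormedType.Exports.
Local Open Scope ring_scope.

Set Implicit Arguments.
Unset Strict Implicit.
Unset Printing Implicit Defensive.

(** The space H(k) is known only through the reproducing property, so the
    elements of H(k) have to be constructed. Two constructions suffice.

    - Smoothing. If g m represents the embedding of N(m, S), then the mean of
      g (m + t c) over a standard normal t represents that of N(m, S + c c^T).
      This mean exists in H(k) by the Riesz representation theorem
      (riesz_representation, rank_one_step), and both its values and its inner
      products come from a one-dimensional Gaussian integral together with the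
      rank-one formulas for determinants and inverses (gauss_mean_profile).
      Every covariance matrix is a sum of matrices c c^T
      (covariance_outer_sum); starting from S = 0, where the embedding is
      k(., m), this places every embedding in H(k) and gives the inner products
      |I + 2 sigma (S + S')|^(-1/2)
        exp (- sigma (m - m')^T (I + 2 sigma (S + S'))^-1 (m - m'))
      (gauss_embedding_in_rkhs). For S = S' = Sigma_0 the matrix is 2 V - I.

    - Differentiation. A Gaussian solves the heat equation: its derivative in
      the covariance along c c^T is half of its second derivative in the mean
      along c. Since B(x) = a a^T - sum c c^T with a = x - m_0, the derivative
      of the embedding along (a, B(x)) combines first and second derivatives in
      the mean. Their central difference quotients converge in H(k), because
      the inner products of two such quotients have a joint limit (cvg_gram),
      and these limits are the inner products of the derivatives (dot_deriv1,
      dot_deriv2, dot0_deriv2). The formulas on rank-one directions extend to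
      B(x) and B(y) by bilinearity (dot_covariance_term,
      dot_linearized_embedding).

    Then f(x) is k(., x) minus the linearized embedding; the reproducing
    property gives the terms of the inner product that involve k(., x) or
    k(., y). *)

(** * Bilinear forms and covariance matrices *)

Section BilinearForms.
Context (R : realType) (d : nat).
Implicit Types (c u v w : 'cV[R]_d) (A B S T : 'M[R]_d).

Lemma bformDl A u v w : bform A (u + v) w = bform A u w + bform A v w.
Proof. by rewrite /bform linearD !mulmxDl mxE. Qed.

Lemma bformDr A u v w : bform A w (u + v) = bform A w u + bform A w v.
Proof. by rewrite /bform mulmxDr mxE. Qed.

Lemma bformZl A a u v : bform A (a *: u) v = a * bform A u v.
Proof. by rewrite /bform linearZ /= -!scalemxAl mxE. Qed.

Lemma bformZr A a u v : bform A u (a *: v) = a * bform A u v.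
Proof. by rewrite /bform -scalemxAr mxE. Qed.

Lemma bform0l A u : bform A 0 u = 0.
Proof. by rewrite -(scale0r 0) bformZl mul0r. Qed.

Lemma bformDA A B u v : bform (A + B) u v = bform A u v + bform B u v.
Proof. by rewrite /bform mulmxDr mulmxDl mxE. Qed.

Lemma bformZA a A u v : bform (a *: A) u v = a * bform A u v.
Proof. by rewrite /bform -scalemxAr -scalemxAl mxE. Qed.

Lemma bformNA A u v : bform (- A) u v = - bform A u v.
Proof. by rewrite -scaleN1r bformZA mulN1r. Qed.

Lemma bformC A u v : A^T = A -> bform A u v = bform A v u.
Proof.
move=> sA; rewrite /bform -[in LHS](trmxK (_ *m v)) mxE.
by rewrite !trmx_mul trmxK sA mulmxA.
Qed.

Lemma bform1 u : bform 1%:M u u = sqnorm2 u.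
Proof.
by rewrite /bform mulmx1 mxE; apply: eq_bigr => i _; rewrite mxE expr2.
Qed.

Lemma sqnorm2_ge0 u : 0 <= sqnorm2 u.
Proof. by apply: sumr_ge0 => i _; rewrite sqr_ge0. Qed.

Lemma sqnorm2_eq0 u : sqnorm2 u = 0 -> u = 0.
Proof.
move=> /psumr_eq0P u0; apply/matrixP => i j; rewrite ord1 mxE.
apply/eqP; rewrite -sqrf_eq0; apply/eqP/u0 => // k _; exact: sqr_ge0.
Qed.

Lemma bform_outer u v c c' : bform (c *m c'^T) u v = bform 1%:M u c * bform 1%:M c' v.
Proof.
rewrite /bform !mulmx1 mulmxA -mulmxA.
by rewrite [LHS]mxE big_ord1.
Qed.

Lemma tr_outer_mul A u v : \tr (u *m v^T *m A) = bform A v u.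
Proof. by rewrite -mulmxA mxtrace_mulC trace_mx11. Qed.

Lemma outer_covariance c : is_covariance (c *m c^T).
Proof.
split=> [|u]; first by rewrite trmx_mul trmxK.
rewrite bform_outer (bformC c u) ?trmx1// -expr2; exact: sqr_ge0.
Qed.

Lemma covarianceD S T : is_covariance S -> is_covariance T ->
  is_covariance (S + T).
Proof.
move=> [sS pS] [sT pT]; split=> [|u]; first by rewrite linearD /= sS sT.
by rewrite bformDA addr_ge0.
Qed.

Definition outer_sum (cs : seq 'cV[R]_d) : 'M[R]_d := \sum_(c <- cs) c *m c^T.

Lemma outer_sum_covariance cs : is_covariance (outer_sum cs).
Proof.
rewrite /outer_sum; elim/big_rec: _ => [|c A _ cA].
  by split=> [|u]; rewrite ?trmx0// /bform mulmx0 mul0mx mxE.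
exact: covarianceD (outer_covariance c) cA.
Qed.

Lemma outer_sum_cons c cs : outer_sum (c :: cs) = outer_sum cs + c *m c^T.
Proof. by rewrite /outer_sum big_cons addrC. Qed.

Lemma bform_delta A i j : bform A (delta_mx i 0) (delta_mx j 0) = A i j.
Proof. by rewrite /bform trmx_delta -rowE -colE !mxE. Qed.

(** Cauchy-Schwarz for a semidefinite form. When S v v = 0 the quadratic
    t |-> S(u + t v, u + t v) is affine and stays nonnegative, so the linear
    coefficient must vanish; otherwise t is taken at the minimum. *)
Lemma covariance_CS S u v : is_covariance S ->
  bform S u v ^+ 2 <= bform S u u * bform S v v.
Proof.
move=> [sS pS].
have q t : 0 <= bform S u u + 2 * t * bform S u v + t ^+ 2 * bform S v v.
  have := pS (u + t *: v).
  rewrite bformDl !bformDr !bformZl !bformZr (bformC v u sS).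
  by congr (_ <= _); ring.
have := pS v; rewrite le_eqVlt => /predU1P[v0|v0].
  rewrite -v0 mulr0; have [->|uv0] := eqVneq (bform S u v) 0.
    by rewrite expr0n.
  (* at this t the affine function of t takes the value -1 *)
  have := q (- (bform S u u + 1) / (2 * bform S u v)).
  rewrite -v0 mulr0 addr0.
  have -> : 2 * (- (bform S u u + 1) / (2 * bform S u v)) * bform S u v =
      - (bform S u u + 1) by field.
  by rewrite opprD addNKr oppr_ge0 ler10.
have := q (- bform S u v / bform S v v).
have -> : bform S u u + 2 * (- bform S u v / bform S v v) * bform S u v +
    (- bform S u v / bform S v v) ^+ 2 * bform S v v =
    (bform S u u * bform S v v - bform S u v ^+ 2) / bform S v v.
  by field; rewrite gt_eqF.
by rewrite pmulr_lge0 ?invr_gt0// subr_ge0.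
Qed.

(** Symmetric elimination. If S i i > 0, subtracting c c^T with
    c = S e_i / sqrt (S i i) clears row i, keeps S semidefinite (this is
    Cauchy-Schwarz for S) and creates no new nonzero diagonal entry; if the
    diagonal is zero then S = 0, again by Cauchy-Schwarz. *)
Lemma covariance_outer_sum S : is_covariance S -> exists cs, S = outer_sum cs.
Proof.
have [n] := ubnP (#|[set i | S i i != 0]|).
elim: n S => // n IHn S leSn cS.
have [sS pS] := cS.
have CSe i j : S i j ^+ 2 <= S i i * S j j.
  by rewrite -!bform_delta covariance_CS.
have [S0|/forallPn[i Sii]] := boolP [forall i, S i i == 0].
  exists [::]; rewrite /outer_sum big_nil; apply/matrixP => i j; rewrite mxE.
  have := CSe i j; rewrite (eqP (forallP S0 i)) mul0r => S2.
  by apply/eqP; rewrite -sqrf_eq0 eq_le S2 sqr_ge0.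
have Sii_gt0 : 0 < S i i by rewrite lt_neqAle eq_sym Sii -bform_delta pS.
pose c := (Num.sqrt (S i i))^-1 *: col i S.
have ccE u v : bform (c *m c^T) u v =
    bform S u (delta_mx i 0) * bform S (delta_mx i 0) v / S i i.
  rewrite bform_outer /c bformZl bformZr.
  have -> : bform 1%:M u (col i S) = bform S u (delta_mx i 0).
    by rewrite /bform mulmx1 colE mulmxA.
  have -> : bform 1%:M (col i S) v = bform S (delta_mx i 0) v.
    by rewrite /bform mulmx1 colE trmx_mul sS.
  rewrite mulrACA -invfM -expr2 sqr_sqrtr ?(ltW Sii_gt0)//; ring.
pose S' := S - c *m c^T.
have S'E u v : bform S' u v = bform S u v -
    bform S u (delta_mx i 0) * bform S (delta_mx i 0) v / S i i.
  by rewrite /S' bformDA bformNA ccE.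
have cS' : is_covariance S'.
  split=> [|u]; first by rewrite linearB /= trmx_mul trmxK sS.
  rewrite S'E (bformC (delta_mx i 0) u sS) -expr2 subr_ge0 ler_pdivrMr//.
  by have := covariance_CS u (delta_mx i 0) cS; rewrite (bform_delta S i i).
have [|cs S'cs] := IHn S' _ cS'.
  have : (#|[set j | S' j j != 0%R]| < #|[set j | S j j != 0%R]|)%N.
    apply: proper_card; apply/properP; split.
      apply/fintype.subsetP => j; rewrite !inE; apply: contra => /eqP Sjj.
      have := CSe j i; rewrite Sjj mul0r => Sji.
      have Sji0 : S j i = 0.
        by apply/eqP; rewrite -sqrf_eq0 eq_le Sji sqr_ge0.
      by rewrite -bform_delta S'E !bform_delta Sjj Sji0 !mul0r subr0.
    exists i; rewrite !inE// negbK -bform_delta S'E !bform_delta.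
    by rewrite mulfK// subrr.
  by move=> lt; apply: leq_trans lt _.
by exists (c :: cs); rewrite outer_sum_cons -S'cs subrK.
Qed.

End BilinearForms.

(** * Rank-one updates of I + 2 sigma S *)

Section RankOneUpdate.
Context (R : realType) (d : nat) (sigma : R) (sigma_gt0 : 0 < sigma).
Implicit Types (c u v w : 'cV[R]_d) (S T : 'M[R]_d).

Lemma Vmx_unit S : is_covariance S -> Vmx sigma S \in unitmx.
Proof.
move=> [sS pS]; rewrite -unitmx_tr -row_free_unit -kermx_eq0.
apply/eqP/row_matrixP => i; rewrite row0.
set u := row i _.
have uV : u *m (Vmx sigma S)^T = 0 by rewrite /u -row_mul mulmx_ker row0.
suff : u^T = 0 by move/(congr1 trmx); rewrite trmxK trmx0.
have : bform (Vmx sigma S)^T u^T u^T = 0.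
  by rewrite /bform trmxK uV mul0mx mxE.
rewrite /Vmx linearD linearZ /= trmx1 sS bformDA bformZA bform1 => H.
apply: sqnorm2_eq0; apply/eqP; rewrite eq_le sqnorm2_ge0 andbT -H lerDl.
by rewrite !mulr_ge0// ltW.
Qed.

Lemma invVmx_covariance S : is_covariance S ->
  is_covariance (invmx (Vmx sigma S)).
Proof.
move=> cS; have [sS pS] := cS; have uV := Vmx_unit cS.
have sV : (Vmx sigma S)^T = Vmx sigma S.
  by rewrite /Vmx linearD linearZ /= trmx1 sS.
have sW : (invmx (Vmx sigma S))^T = invmx (Vmx sigma S).
  by rewrite trmx_inv sV.
split=> // u; set W := invmx _ in sW *.
have -> : bform W u u = bform (Vmx sigma S) (W *m u) (W *m u).
  by rewrite /bform trmx_mul sW mulmxA mulmxKV// mulmxA.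
by rewrite bformDA bformZA bform1 addr_ge0 ?sqnorm2_ge0// !mulr_ge0// ltW.
Qed.

(** Weinstein-Aronszajn identity in rank one: two block triangular
    factorizations of the matrix with rows (1, -c) and (w, 1) are compared. *)
Lemma det_1Dmul (c : 'cV[R]_d) (w : 'rV[R]_d) :
  \det (1%:M + c *m w) = 1 + (w *m c) 0 0.
Proof.
have e1 : block_mx 1%:M (- c) w (1%:M : 'M[R]_1) =
    block_mx 1%:M 0 w 1%:M *m block_mx 1%:M (- c) 0 (1%:M + w *m c).
  by rewrite mulmx_block !(mulmx1, mul1mx, mul0mx, mulmx0, addr0, add0r)
    mulmxN addrCA addNr addr0.
have e2 : block_mx 1%:M (- c) w (1%:M : 'M[R]_1) =
    block_mx 1%:M (- c) 0 1%:M *m block_mx (1%:M + c *m w) 0 w 1%:M.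
  by rewrite mulmx_block !(mulmx1, mul1mx, mul0mx, mulmx0, addr0, add0r)
    mulNmx addrK.
have := congr1 determinant (etrans (esym e2) e1).
rewrite !det_mulmx !det_ublock !det_lblock !det1 !mul1r mulr1 => ->.
by rewrite det_mx11 !mxE eqxx.
Qed.

Lemma VmxD S T : Vmx sigma (S + T) = Vmx sigma S + (2 * sigma) *: T.
Proof. by rewrite /Vmx scalerDr addrA. Qed.

Lemma VmxD_outer S c : is_covariance S ->
  Vmx sigma (S + c *m c^T) =
  Vmx sigma S *m
    (1%:M + invmx (Vmx sigma S) *m ((2 * sigma) *: c) *m c^T).
Proof.
move=> cS; rewrite VmxD mulmxDr mulmx1 !mulmxA mulmxV ?Vmx_unit// mul1mx.
by rewrite -scalemxAl.
Qed.

Lemma det_VmxD_outer S c : is_covariance S ->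
  \det (Vmx sigma (S + c *m c^T)) =
  \det (Vmx sigma S) * (1 + 2 * sigma * bform (invmx (Vmx sigma S)) c c).
Proof.
move=> cS; rewrite VmxD_outer// det_mulmx det_1Dmul mulmxA.
by rewrite -[(_ *m _) 0 0]/(bform _ _ _) bformZr.
Qed.

Lemma det_Vmx_gt0 S : is_covariance S -> 0 < \det (Vmx sigma S).
Proof.
move=> /covariance_outer_sum[cs ->]; elim: cs => [|c cs IH].
  by rewrite /outer_sum big_nil /Vmx scaler0 addr0 det1.
rewrite outer_sum_cons det_VmxD_outer; last exact: outer_sum_covariance.
rewrite mulr_gt0// ltr_wpDr// !mulr_ge0 ?(ltW sigma_gt0)//.
by case: (invVmx_covariance (outer_sum_covariance cs)).
Qed.

(** Sherman-Morrison formula, restricted to quadratic forms. The vector w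
    in the proof is the candidate for the solution of V' w = u. *)
Lemma bform_invVmxD_outer S c u : is_covariance S ->
  let W := invmx (Vmx sigma S) in
  bform (invmx (Vmx sigma (S + c *m c^T))) u u =
  bform W u u - 2 * sigma * bform W u c ^+ 2 / (1 + 2 * sigma * bform W c c).
Proof.
move=> cS W; have [sW pW] := invVmx_covariance cS; rewrite -/W in sW pW.
have uV' : Vmx sigma (S + c *m c^T) \in unitmx.
  exact/Vmx_unit/covarianceD/outer_covariance.
set r := bform W c c; set q := bform W u c.
have r0 : 1 + 2 * sigma * r != 0.
  by rewrite gt_eqF// ltr_wpDr// !mulr_ge0 ?pW// ltW.
pose w := W *m u - (2 * sigma * q / (1 + 2 * sigma * r)) *: (W *m c).
have uE : u = Vmx sigma (S + c *m c^T) *m w.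
  have wE A : A *m w =
      A *m W *m u - (2 * sigma * q / (1 + 2 * sigma * r)) *: (A *m W *m c).
    by rewrite /w mulmxBr -scalemxAr !mulmxA.
  rewrite VmxD mulmxDl -scalemxAl !wE mulmxV ?Vmx_unit// !mul1mx.
  have -> : c *m c^T *m W *m u = q *: c.
    rewrite -!mulmxA [c^T *m _]mx11_scalar mul_mx_scalar mulmxA.
    by rewrite -/(bform W c u) (bformC c u sW).
  have -> : c *m c^T *m W *m c = r *: c.
    by rewrite -!mulmxA [c^T *m _]mx11_scalar mul_mx_scalar mulmxA.
  apply/matrixP => i j; rewrite !mxE; field.
  exact: r0.
have -> : bform (invmx (Vmx sigma (S + c *m c^T))) u u = bform 1%:M u w.
  by rewrite /bform -mulmxA [in invmx _ *m u]uE mulKmx// mulmx1.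
rewrite (bformC u w) ?trmx1// /w bformDl -scaleN1r !bformZl.
have h v : bform 1%:M (W *m v) u = bform W v u.
  by rewrite /bform mulmx1 trmx_mul sW.
by rewrite !h (bformC c u sW) -/q; ring.
Qed.
End RankOneUpdate.

(** * Hilbert space tools *)

Section HilbertSpace.
Local Open Scope classical_set_scope.
Context (R : realType) (H : completeNormedModType R) (dot : {dot H for idfun}).
Context (dotE : forall h : H, `|h| ^+ 2 = dot h h).
Implicit Types (u v g h : H).

Lemma dotC u v : dot u v = dot v u.
Proof. by rewrite hermitian_subproof expr0 mul1r. Qed.

Lemma dotZl a u v : dot (a *: u) v = a * dot u v.
Proof. by rewrite linearZl_LR. Qed.

Lemma dotZr a u v : dot u (a *: v) = a * dot u v.
Proof. by rewrite linearZr_LR. Qed.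

Lemma dotDl u v h : dot (u + v) h = dot u h + dot v h.
Proof. by rewrite linearDl. Qed.

Lemma dotDr u v h : dot h (u + v) = dot h u + dot h v.
Proof. by rewrite linearDr. Qed.

Lemma dotBl u v h : dot (u - v) h = dot u h - dot v h.
Proof. by rewrite linearBl. Qed.

Lemma dotBr u v h : dot h (u - v) = dot h u - dot h v.
Proof. by rewrite linearBr. Qed.

Lemma sqr_normB u v : `|u - v| ^+ 2 = dot u u - 2 * dot u v + dot v v.
Proof. by rewrite dotE dotBl !dotBr (dotC v u); ring. Qed.

Lemma dot_CS u v : `|dot u v| <= `|u| * `|v|.
Proof.
rewrite -ler_sqr ?nnegrE ?mulr_ge0// exprMn real_normK ?num_real// !dotE.
have [->|v0] := eqVneq v 0.
  by rewrite -(scale0r v) !dotZr !mul0r mulr0 expr0n.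
have vv : 0 < dot v v by rewrite -dotE exprn_gt0// normr_gt0.
have := sqr_ge0 `|u - (dot u v / dot v v) *: v|.
rewrite sqr_normB !dotZr dotZl.
have -> : dot u u - 2 * (dot u v / dot v v * dot u v) +
    dot u v / dot v v * (dot u v / dot v v * dot v v) =
    (dot u u * dot v v - dot u v ^+ 2) / dot v v.
  by field; rewrite gt_eqF.
by rewrite pmulr_lge0 ?invr_gt0// subr_ge0.
Qed.

Lemma cvg_dot (T : Type) (F : set_system T) (FF : Filter F)
    (f f' : T -> H) u v :
  f @ F --> u -> f' @ F --> v -> dot (f t) (f' t) @[t --> F] --> dot u v.
Proof.
move=> fu fv.
have pol a b : dot a b = (`|a + b| ^+ 2 - `|a - b| ^+ 2) / 4.
  rewrite sqr_normB dotE dotDl !dotDr (dotC b a); lra.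
under eq_cvg do rewrite pol; rewrite pol.
apply: cvgMr_tmp; apply: cvgB; under eq_cvg do rewrite expr2; rewrite expr2.
  by apply: cvgM; apply: cvg_norm; apply: cvgD.
by apply: cvgM; apply: cvg_norm; apply: cvgB.
Qed.

(** The Gram criterion: since |f p - f q|^2 is an alternating sum of inner
    products of values of f, a joint limit of these inner products makes f
    Cauchy. *)
Lemma cvg_gram (T : Type) (F : set_system T) (FF : ProperFilter F)
    (f : T -> H) (l : R) :
  dot (f p.1) (f p.2) @[p --> (F, F)] --> l -> cvg (f @ F).
Proof.
move=> fl; apply: cauchy_cvg; apply: cauchy_exP => e e0.
have e4 : 0 < e ^+ 2 / 4 by rewrite divr_gt0 ?exprn_gt0.
move/cvgrPdist_lt : fl => /(_ _ e4)[[A B]/= [FA FB] AB].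
have FAB : F (A `&` B) by exact: filterI.
have [t0 [At0 Bt0]] := filter_ex FAB.
exists (f t0); apply: filterS FAB => t [At Bt].
rewrite -ball_normE /= -ltr_sqr ?nnegrE ?normr_ge0 ?(ltW e0)//.
rewrite sqr_normB.
have := AB (t0, t0) (conj At0 Bt0); have := AB (t0, t) (conj At0 Bt).
have := AB (t, t) (conj At Bt); rewrite /= !ltr_norml.
move: (dot _ _) (dot _ _) (dot _ _) (e ^+ 2) => a b c ee.
lra.
Qed.

(** The representative minimizes J h = |h|^2 - 2 L h. By the parallelogram
    law a minimizing sequence is Cauchy, and the first variation of J vanishes
    at its limit. *)
Lemma riesz_representation (L : H -> R) (C : R) :
  (forall a u v, L (a *: u + v) = a * L u + L v) ->
  (forall h, `|L h| <= C * `|h|) ->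
  exists g, forall h, dot g h = L h.
Proof.
move=> Llin LC.
pose J h := `|h| ^+ 2 - 2 * L h.
have Jlb h : - C ^+ 2 <= J h.
  have := le_trans (ler_norm _) (LC h); rewrite /J.
  have := sqr_ge0 (`|h| - C); nra.
have Jinf : has_inf (range J).
  split; first by exists (J 0), 0.
  by exists (- C ^+ 2) => _ [h _ <-].
set m := inf (range J).
have mJ h : m <= J h by apply: ge_inf; [case: Jinf|exists h].
have Jm n : exists h, J h < m + n.+1%:R^-1.
  have n0 : 0 < n.+1%:R^-1 :> R by rewrite invr_gt0.
  have [_ [h _ <-] ?] := inf_adherent n0 Jinf.
  by exists h.
have Lline u t h : J (u + t *: h) = J u + 2 * t * (dot u h - L h) + t ^+ 2 * `|h| ^+ 2.
  rewrite /J dotE [u + _]addrC Llin dotDl !dotDr !dotZl !dotZr -!dotE (dotC h u); ring.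
have [u uJ] := choice Jm.
have par v w : `|v - w| ^+ 2 <= 2 * (J v + J w - 2 * m).
  have := mJ (2^-1 *: (v + w)); rewrite /J sqr_normB !dotE.
  have -> : 2^-1 *: (v + w) = 2^-1 *: v + 2^-1 *: w by rewrite scalerDr.
  have L0 : L 0 = 0.
    by have := Llin (-1) 0 0; rewrite scaler0 addr0 mulN1r addNr.
  have -> : L (2^-1 *: v + 2^-1 *: w) = (L v + L w) / 2.
    rewrite Llin -[2^-1 *: w]addr0 Llin L0; lra.
  rewrite dotDl !dotDr !dotZl !dotZr (dotC w v); lra.
have cu : cvg (u @ \oo).
  apply: cauchy_cvg; apply: cauchy_exP => e e0.
  have e4 : 0 < e ^+ 2 / 4 by rewrite divr_gt0 ?exprn_gt0.
  have [N _ Ne] : \forall n \near \oo, n.+1%:R^-1 < e ^+ 2 / 4.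
    exact: near_infty_natSinv_lt (PosNum e4).
  exists (u N), N => // n /= Nn; rewrite -ball_normE /=.
  rewrite -ltr_sqr ?nnegrE ?normr_ge0 ?(ltW e0)//; apply: le_lt_trans (par _ _) _.
  have := uJ N; have := uJ n; have := Ne N (leqnn _); have := Ne n Nn.
  move: (J _) (J _) (n.+1%:R^-1) (N.+1%:R^-1) (e ^+ 2) => *; lra.
exists (lim (u @ \oo)) => h; set g := lim _.
have ineq t : 0 <= 2 * t * (dot g h - L h) + t ^+ 2 * `|h| ^+ 2.
  have lhs : (2 * t * (dot (u n) h - L h) + t ^+ 2 * `|h| ^+ 2 + n.+1%:R^-1)
      @[n --> \oo] --> 2 * t * (dot g h - L h) + t ^+ 2 * `|h| ^+ 2 + 0.
    apply: cvgD; last exact: cvg_harmonic.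
    apply: cvgD; last exact: cvg_cst.
    apply: cvgMl_tmp; apply: cvgB; last exact: cvg_cst.
    by apply: (cvg_dot _ cu (cvg_cst h)).
  rewrite -[leRHS]addr0; apply: (cvgr_to_ge lhs).
  near=> n; have := mJ (u n + t *: h); rewrite Lline; have := uJ n.
  move: (J (u n)) (n.+1%:R^-1) (2 * t * _) (t ^+ 2 * _) => *; lra.
have [h0|h0] := eqVneq h 0.
  have L0 : L 0 = 0.
    by have := Llin (-1) 0 0; rewrite scaler0 addr0 mulN1r addNr.
  by rewrite h0 L0 -(scale0r 0) dotZr mul0r.
have hh : 0 < `|h| ^+ 2 by rewrite exprn_gt0// normr_gt0.
have := ineq (- (dot g h - L h) / `|h| ^+ 2).
set x := dot g h - L h; move: (`|h| ^+ 2) hh => N N0.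
have -> : 2 * (- x / N) * x + (- x / N) ^+ 2 * N = - (x ^+ 2 / N).
  by field; rewrite gt_eqF.
rewrite oppr_ge0 pmulr_lle0 ?invr_gt0// => x0.
apply/eqP; rewrite -subr_eq0 -sqrf_eq0 eq_le -/x x0; exact: sqr_ge0.
Unshelve. all: by end_near. Qed.
End HilbertSpace.

(** * The mean over a standard normal variable *)

Section GaussianMean.
Local Open Scope classical_set_scope.
Context (R : realType).
Implicit Types (f g : R -> R).

(** Expectation of f(t) for a standard normal variable t. *)
Definition gauss_mean f : R :=
  \int[lebesgue_measure]_t (f t * normal_pdf 0 1 t).

Definition bounded_continuous f := continuous f /\ exists C, forall t, `|f t| <= C.

Lemma integrable_gauss f : bounded_continuous f ->
  lebesgue_measure.-integrable [set: R] (EFin \o (fun t => f t * normal_pdf 0 1 t)).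
Proof.
move=> [cf [C fC]].
apply: (@le_integrable _ _ _ lebesgue_measure _ measurableT _ 
  (fun t => (C * normal_pdf 0 1 t)%:E)).
- apply/measurable_EFinP; apply: measurable_funM.
    exact: continuous_measurable_fun.
  exact: measurable_normal_pdf.
- move=> t _ /=; rewrite lee_fin !normrM ler_wpM2r//.
  exact: le_trans (fC t) (ler_norm _).
- have := integrableZl measurableT C (integrable_normal_pdf (0:R) 1).
  exact.
Qed.

Lemma gauss_mean_lin a f g : bounded_continuous f -> bounded_continuous g ->
  gauss_mean (fun t => a * f t + g t) = a * gauss_mean f + gauss_mean g.
Proof.
move=> bf bg; rewrite /gauss_mean -RintegralZl//; last exact: integrable_gauss.
rewrite -RintegralD//; last 2 first.
- have := integrableZl measurableT a (integrable_gauss bf); exact.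
- exact: integrable_gauss.
by apply: eq_Rintegral => t _; rewrite mulrDl mulrA.
Qed.

Lemma Rintegral_normal_pdf m s :
  \int[lebesgue_measure]_t (normal_pdf m s t : R) = 1.
Proof. by rewrite /Rintegral integral_normal_pdf. Qed.

Lemma gauss_mean_bound f C : continuous f -> (forall t, `|f t| <= C) ->
  `|gauss_mean f| <= C.
Proof.
move=> cf fC; have bf : bounded_continuous f by split=> //; exists C.
apply: le_trans (le_normr_Rintegral _ (integrable_gauss bf)) _ => //.
have -> : C = \int[lebesgue_measure]_t (C * normal_pdf 0 1 t : R).
  rewrite RintegralZl// ?Rintegral_normal_pdf ?mulr1//.
  exact: integrable_normal_pdf.
apply: le_Rintegral => //.
- by have := integrable_abse (integrable_gauss bf); exact.
- by have := integrableZl measurableT C (integrable_normal_pdf (0:R) 1); exact.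
- move=> t _; rewrite normrM (ger0_norm (normal_pdf_ge0 _ _ _)) ler_wpM2r//.
  exact: normal_pdf_ge0.
Qed.

Lemma powRNhalf (a : R) : 0 <= a -> a `^ (- 2^-1) = (Num.sqrt a)^-1.
Proof. by move=> a0; rewrite powRN powR12_sqrt. Qed.

(** Completing the square turns the integrand into a multiple of the normal
    density with mean - beta / (1 + 2 alpha) and variance 1 / (1 + 2 alpha). *)
Lemma gauss_mean_quadratic (K alpha beta : R) : 0 <= alpha ->
  gauss_mean (fun t => K * expR (- (beta * t + alpha * t ^+ 2))) =
  K * (1 + 2 * alpha) `^ (- 2^-1) * expR (beta ^+ 2 / (2 * (1 + 2 * alpha))).
Proof.
move=> a0; set v := 1 + 2 * alpha.
have v0 : 0 < v by rewrite /v ltr_wpDr// mulr_ge0.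
rewrite powRNhalf ?ltW//; set s := (Num.sqrt v)^-1; set E := expR _.
have s0 : 0 < s by rewrite invr_gt0 sqrtr_gt0.
have s2 : s ^+ 2 = v^-1 by rewrite exprVn sqr_sqrtr ?ltW.
rewrite /gauss_mean.
transitivity (\int[lebesgue_measure]_t (K * s * E * normal_pdf (- beta / v) s t)).
  apply: eq_Rintegral => t _.
  rewrite -!mulrA; congr (_ * _).
  rewrite !normal_pdfE ?oner_eq0 ?gt_eqF// /normal_peak /normal_fun.
  rewrite -[s ^+ 2 * pi *+ 2]mulrnAr sqrtrM ?sqr_ge0// sqrtr_sqr gtr0_norm//.
  rewrite invfM expr1n mul1r; set p := (Num.sqrt _)^-1.
  rewrite mulrCA [RHS]mulrCA.
  rewrite (mulrA s) (mulrA s) divff ?gt_eqF// mul1r [RHS]mulrCA.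
  congr (_ * _); rewrite -!expRD; congr expR.
  by rewrite subr0 s2 /v; field; rewrite gt_eqF.
rewrite RintegralZl// ?Rintegral_normal_pdf ?mulr1//.
exact: integrable_normal_pdf.
Qed.

End GaussianMean.

(** * The Gaussian profile and its smoothing along a line *)

Section Profile.
Local Open Scope classical_set_scope.
Context (R : realType) (d : nat) (sigma : R) (sigma_gt0 : 0 < sigma).
Implicit Types (c u v w : 'cV[R]_d) (S T : 'M[R]_d).

(** The embedding of N(m, T) at z is the profile of T at z - m. The profile
    also gives the inner products: those of the embeddings of N(m, S) and
    N(m', S') are the profile of S + S' at m - m'. *)
Definition gauss_profile T u : R :=
  \det (Vmx sigma T) `^ (- 2^-1)
  * expR (- sigma * bform (invmx (Vmx sigma T)) u u).

Lemma gauss_profileN T u : gauss_profile T (- u) = gauss_profile T u.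
Proof.
by rewrite /gauss_profile -[- u]scaleN1r bformZl bformZr !mulN1r opprK.
Qed.

Lemma gauss_profile0 u : gauss_profile 0 u = expR (- sigma * sqnorm2 u).
Proof.
by rewrite /gauss_profile /Vmx scaler0 addr0 det1 powR1 mul1r invmx1 bform1.
Qed.

Lemma gauss_profile_line S u c t : is_covariance S ->
  let W := invmx (Vmx sigma S) in
  gauss_profile S (u - t *: c) = gauss_profile S u *
    expR (- (- (2 * sigma * bform W u c) * t + sigma * bform W c c * t ^+ 2)).
Proof.
move=> cS W; have [sW _] := invVmx_covariance sigma_gt0 cS.
rewrite /gauss_profile -mulrA -expRD -/W; congr (_ * expR _).
rewrite -scaleNr bformDl !bformDr !bformZl !bformZr (bformC c u sW); ring.
Qed.

(** Smoothing a Gaussian along c by an independent standard normal variable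
    adds c c^T to its covariance. The determinant and the quadratic form are
    matched by the two rank-one update formulas. *)
Lemma gauss_mean_profile S u c : is_covariance S ->
  gauss_mean (fun t => gauss_profile S (u - t *: c)) =
  gauss_profile (S + c *m c^T) u.
Proof.
move=> cS; have [sW pW] := invVmx_covariance sigma_gt0 cS.
under [X in gauss_mean X]funext do rewrite gauss_profile_line//.
have sr : 0 <= sigma * bform (invmx (Vmx sigma S)) c c.
  by rewrite mulr_ge0 ?pW ?ltW.
rewrite gauss_mean_quadratic// /gauss_profile.
rewrite det_VmxD_outer// bform_invVmxD_outer// mulrA.
set r := bform _ c c in sr *; set q := bform _ u c.
have v0 : 0 < 1 + 2 * sigma * r by rewrite ltr_wpDr// -mulrA mulr_ge0.
rewrite powRM ?(ltW v0) ?(ltW (det_Vmx_gt0 _ _))//.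
rewrite [X in X * _ = _]mulrAC -[LHS]mulrA -expRD; congr (_ * expR _).
by field; rewrite gt_eqF.
Qed.

Lemma cvg_gauss_profile S c :
  gauss_profile S (t *: c) @[t --> (0:R)] --> gauss_profile S 0.
Proof.
rewrite /gauss_profile bform0l mulr0.
under eq_cvg do rewrite bformZl bformZr mulrA mulrC.
rewrite mulrC; apply: cvgMr_tmp.
apply: (cvg_comp _ expR); last exact: continuous_expR.
pose b := - sigma * bform (invmx (Vmx sigma S)) c c.
have : b * (t * t) @[t --> (0 : R)] --> b * (0 * 0).
  by apply: cvgMl_tmp; apply: cvgM; exact: cvg_id.
have -> : (fun t => b * (t * t)) =
    (fun t => - sigma * (t * t * bform (invmx (Vmx sigma S)) c c)).
  by apply/funext => t; rewrite /b; ring.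
by rewrite !mulr0.
Qed.

End Profile.

(** * Mean embeddings as elements of the RKHS *)

Section Embedding.
Local Open Scope classical_set_scope.
Context (R : realType) (d : nat) (sigma : R) (sigma_gt0 : 0 < sigma).
Context (H : rkhs (@gauss_kernel R d sigma)).
Implicit Types (c u v w m z : 'cV[R]_d) (S T : 'M[R]_d) (g : 'cV[R]_d -> H).
Notation dot := (rkhs_dot H).
Notation G := (gauss_profile sigma).
Let dotE := @rkhs_normE _ _ _ H.

Definition embeds S g := forall m, rkhs_eval H (g m) = gauss_embedding sigma m S.

(** Quantifying over every other embedded family g', rather than stating the
    inner products inside one family, is what makes the induction on the
    number of rank-one terms go through: the inner product with a fixed g' m'
    is then again a profile, to be smoothed along c. *)
Definition coherent S g := forall S' g', is_covariance S' -> embeds S' g' ->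
  forall m m', dot (g m) (g' m') = G (S + S') (m - m').

Lemma embeds_dot S g m z : embeds S g -> dot (g m) (rkhs_section H z) = G S (z - m).
Proof. by move=> gE; rewrite rkhs_reproducing gE. Qed.

Lemma embeds_section : embeds 0 (rkhs_section H).
Proof.
move=> m; apply/funext => z; rewrite rkhs_sectionE.
by rewrite -[RHS]/(G 0 (z - m)) gauss_profile0.
Qed.

Lemma coherent_section : coherent 0 (rkhs_section H).
Proof.
move=> S' g' cS' gE m m'; rewrite dotC (embeds_dot _ _ gE).
by rewrite add0r.
Qed.

(** Continuity along lines, needed so that inner products with g (m + t c)
    can be integrated in t. *)
Lemma cvg_embedding S g m c (s : R) : is_covariance S -> embeds S g -> coherent S g ->
  g (m + t *: c) @[t --> s] --> g (m + s *: c).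
Proof.
move=> cS gE gc.
have nE (t : R) : `|g (m + s *: c) - g (m + t *: c)| ^+ 2 =
    2 * (G (S + S) 0 - G (S + S) ((t - s) *: c)).
  rewrite (sqr_normB dotE) !(gc S g)// !subrr.
  have -> : m + s *: c - (m + t *: c) = - ((t - s) *: c).
    by rewrite scalerBl opprB opprD addrACA subrr add0r.
  rewrite gauss_profileN; ring.
have c0 : 2 * (G (S + S) 0 - G (S + S) ((t - s) *: c)) @[t --> s] --> (0 : R).
  rewrite -[X in _ --> X](mulr0 2) -(subrr (G (S + S) 0)).
  apply: cvgMl_tmp; apply: cvgB; first exact: cvg_cst.
  have ts : (t - s) @[t --> s] --> (0 : R).
    have : (t - s) @[t --> s] --> s - s by apply: cvgB; [exact: cvg_id|exact: cvg_cst].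
    by rewrite subrr.
  by have := cvg_comp _ _ ts (@cvg_gauss_profile _ _ sigma (S + S) c); exact.
apply/cvgrPdist_lt => e e0.
have e20 : 0 < e ^+ 2 by rewrite exprn_gt0.
move/cvgr0Pnorm_lt : c0 => /(_ _ e20); apply: filterS => t.
rewrite -nE ger0_norm ?sqr_ge0// => lt.
by rewrite -ltr_sqr ?nnegrE ?normr_ge0 ?(ltW e0).
Qed.

(** The new element is the Bochner mean of g (m + t c) over a standard
    normal t, obtained weakly: h |-> E <g (m + t c), h> is a bounded functional
    because the norm of g m does not depend on m. Testing it on k(., z) and on
    g' m' gives the two required properties by the same smoothing formula. *)
Lemma rank_one_step S g c : is_covariance S -> embeds S g -> coherent S g ->
  exists2 g', embeds (S + c *m c^T) g' & coherent (S + c *m c^T) g'.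
Proof.
move=> cS gE gc; have cSS := covarianceD cS cS.
pose C := Num.sqrt (G (S + S) 0).
have gC m : `|g m| = C.
  by rewrite -[LHS]ger0_norm// -sqrtr_sqr dotE (gc S g)// subrr.
pose phi m h (t : R) := dot (g (m + t *: c)) h.
have phic m h : continuous (phi m h).
  move=> s; apply: (cvg_dot dotE); last exact: cvg_cst.
  by have := cvg_embedding (m := m) (c := c) (s := s) cS gE gc; exact.
have phib m h t : `|phi m h t| <= C * `|h|.
  by rewrite -(gC (m + t *: c)); exact: dot_CS.
have bphi m h : bounded_continuous (phi m h) by split=> //; exists (C * `|h|).
have /choice[g' g'E] m : exists x : H, forall h, dot x h = gauss_mean (phi m h).
  apply: (riesz_representation dotE (C := C)) => [a u v|h]; last exact: gauss_mean_bound.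
  rewrite -gauss_mean_lin//; congr gauss_mean; apply/funext => t.
  by rewrite /phi dotDr dotZr.
exists g' => [m|S' e' cS' e'E m m'].
  apply/funext => z; rewrite -rkhs_reproducing g'E.
  rewrite -[RHS]/(G (S + c *m c^T) (z - m)) -gauss_mean_profile//.
  congr gauss_mean; apply/funext => t.
  by rewrite /phi (embeds_dot _ _ gE) opprD addrA.
rewrite g'E addrAC -gauss_profileN opprB -(gauss_mean_profile sigma_gt0 _ _ (covarianceD cS cS')).
congr gauss_mean; apply/funext => t.
by rewrite /phi (gc S')// -gauss_profileN opprB opprD addrA.
Qed.

Lemma gauss_embedding_in_rkhs S : is_covariance S ->
  exists2 g, embeds S g & coherent S g.
Proof.
move=> /covariance_outer_sum[cs ->]; elim: cs => [|c cs [g gE gc]].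
  rewrite /outer_sum big_nil; exists (rkhs_section H).
    exact: embeds_section.
  exact: coherent_section.
by rewrite outer_sum_cons; apply: rank_one_step gE gc; exact: outer_sum_covariance.
Qed.

End Embedding.

(** * The difference quotient of the exponential at 0 *)

Section ExpSlope.
Local Open Scope classical_set_scope.
Context (R : realType).
Implicit Types (x w : R).

(** Writing expR x - 1 as x times a function continuous at 0 turns every
    difference quotient below into an expression without division. *)
Definition exp_slope x : R := if x == 0 then 1 else (expR x - 1) / x.

Lemma exp_slopeE x : expR x = 1 + x * exp_slope x.
Proof.
rewrite /exp_slope; have [->|x0] := eqVneq x 0; first by rewrite expR0 mul0r addr0.
by field.
Qed.

(** Makes the factor w of expR w - expR (- w) explicit. *)
Lemma expR_odd w : expR w = expR (- w) * (1 + 2 * w * exp_slope (2 * w)).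
Proof.
by rewrite -exp_slopeE -expRD; congr expR; ring.
Qed.

(** Makes the factor w^2 of expR w + expR (- w) - 2 explicit. *)
Lemma expR_even w :
  expR w = 2 - expR (- w) + expR (- w) * (w * exp_slope w) ^+ 2.
Proof.
have -> : w * exp_slope w = expR w - 1 by rewrite [expR w]exp_slopeE; ring.
by rewrite expRN; field; rewrite gt_eqF ?expR_gt0.
Qed.

Lemma cvg_exp_slope (T : Type) (F : set_system T) (FF : Filter F) (f : T -> R) :
  f @ F --> (0 : R) -> exp_slope (f t) @[t --> F] --> (1 : R).
Proof.
move=> f0; have c0 : {for (0 : R), continuous exp_slope}.
  apply/continuous_withinNx.
  have -> : exp_slope 0 = 1 :> R by rewrite /exp_slope eqxx.
  have [dx dE] := is_derive_expR (0 : R).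
  have l : h^-1 *: (expR (h *: 1 + 0) - expR 0) @[h --> (0 : R)^'] -->
      'D_1 expR (0 : R) by exact: dx.
  rewrite dE expR0 in l; apply: cvg_trans l; apply: near_eq_cvg.
  near=> h; have h0 : h != 0 by near: h; exact: nbhs_dnbhs_neq.
  by rewrite /exp_slope (negbTE h0) addr0 /GRing.scale /= mulr1 mulrC.
have -> : (1 : R) = exp_slope 0 by rewrite /exp_slope eqxx.
exact: (cvg_comp _ _ f0 c0).
Unshelve. all: by end_near. Qed.

Lemma cvg_expR (T : Type) (F : set_system T) (FF : Filter F) (f : T -> R) :
  f @ F --> (0 : R) -> expR (f t) @[t --> F] --> (1 : R).
Proof.
move=> f0; rewrite -(expR0 R).
exact: (cvg_comp _ _ f0 (@continuous_expR R 0)).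
Qed.

End ExpSlope.

(** * Derivatives of the embedding with respect to the mean *)

Section Derivatives.
Local Open Scope classical_set_scope.
Context (R : realType) (d : nat) (sigma : R) (sigma_gt0 : 0 < sigma).
Context (H : rkhs (@gauss_kernel R d sigma)).
Implicit Types (b c u v w z : 'cV[R]_d) (S T : 'M[R]_d) (t s : R).
Notation dot := (rkhs_dot H).
Notation G := (gauss_profile sigma).
Let dotE := @rkhs_normE _ _ _ H.
Context (S : 'M[R]_d) (g : 'cV[R]_d -> H) (m : 'cV[R]_d).
Context (cS : is_covariance S) (gE : embeds S g) (gc : coherent S g).

Let U := invmx (Vmx sigma (S + S)).
Let K := \det (Vmx sigma (S + S)) `^ (- 2^-1).

Definition central_slope c t : H := (2 * t)^-1 *: (g (m + t *: c) - g (m + (- t) *: c)).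

(** Half of the second central difference quotient: a change of covariance
    in the direction c c^T acts on a Gaussian as half of its second derivative
    in the mean along c (the heat equation). *)
Definition central_curvature c t : H :=
  (2 * t ^+ 2)^-1 *: (g (m + t *: c) + g (m + (- t) *: c) - 2 *: g m).

(** Along two lines through m the inner product is K times the exponential
    of a quadratic polynomial in (t, s); only its cross term couples t and s. *)
Lemma dot_line c b t s : dot (g (m + t *: c)) (g (m + s *: b)) =
  K * (expR (- (sigma * bform U c c * t ^+ 2)) *
       expR (- (sigma * bform U b b * s ^+ 2)) *
       expR (2 * sigma * bform U c b * t * s)).
Proof.
have [sU _] := invVmx_covariance sigma_gt0 (covarianceD cS cS).
rewrite (gc cS gE) /gauss_profile -/K -/U -!expRD; congr (_ * expR _).
have -> : m + t *: c - (m + s *: b) = t *: c + (- s) *: b.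
  by rewrite opprD addrACA subrr add0r scaleNr.
rewrite bformDl !bformDr !bformZl !bformZr (bformC b c sU); ring.
Qed.

Lemma dot_line0 c t : dot (g m) (g (m + t *: c)) =
  K * expR (- (sigma * bform U c c * t ^+ 2)).
Proof.
have := dot_line c c 0 t; rewrite scale0r addr0 => ->.
by rewrite expr0n /= !mulr0 mul0r oppr0 expR0 mul1r mulr1.
Qed.

Lemma dot_00 : dot (g m) (g m) = K.
Proof.
by have := dot_line0 0 0; rewrite scale0r addr0 expr0n /= mulr0 oppr0 expR0 mulr1.
Qed.

Lemma dot_line_section c t z :
  dot (g (m + t *: c)) (rkhs_section H z) = gauss_embedding sigma m S z *
    (expR (- (sigma * bform (invmx (Vmx sigma S)) c c * t ^+ 2)) *
     expR (2 * sigma * bform (invmx (Vmx sigma S)) (z - m) c * t)).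
Proof.
rewrite (embeds_dot _ _ gE) opprD addrA gauss_profile_line// -expRD.
by congr (_ * expR _); ring.
Qed.

(** The limits are taken along an arbitrary filter with two vanishing steps
    t and s. Independent steps give the Cauchy property of the difference
    quotients, equal steps give the inner products of their limits. *)
Section Limits.
Context (T : Type) (F : set_system T) (FF : ProperFilter F) (t s : T -> R).
Context (t0 : t @ F --> (0 : R)) (s0 : s @ F --> (0 : R)).
Context (tN0 : \forall p \near F, t p != 0) (sN0 : \forall p \near F, s p != 0).

Let cvg0M (a b : T -> R) : a @ F --> (0 : R) -> b @ F --> (0 : R) ->
  a p * b p @[p --> F] --> (0 : R).
Proof. by move=> a0 b0; rewrite -(mulr0 0); exact: cvgM. Qed.

Let cvg0Ml (k : R) (a : T -> R) : a @ F --> (0 : R) ->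
  k * a p @[p --> F] --> (0 : R).
Proof. by move=> a0; rewrite -(mulr0 k); exact: cvgMl_tmp. Qed.

Let cvg0N (a : T -> R) : a @ F --> (0 : R) -> - a p @[p --> F] --> (0 : R).
Proof. by move=> a0; rewrite -oppr0; exact: cvgN. Qed.

Lemma cvg_dot_central_slope c b :
  dot (central_slope c (t p)) (central_slope b (s p)) @[p --> F] --> K * (2 * sigma * bform U c b).
Proof.
set x := sigma * bform U c c; set y := sigma * bform U b b.
set w := 2 * sigma * bform U c b.
have ts0 : w * (t p * s p) @[p --> F] --> (0 : R) by apply/cvg0Ml/cvg0M.
have xt0 : - (x * (t p * t p)) @[p --> F] --> (0 : R) by apply/cvg0N/cvg0Ml/cvg0M.
have ys0 : - (y * (s p * s p)) @[p --> F] --> (0 : R) by apply/cvg0N/cvg0Ml/cvg0M.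
apply: (cvg_trans (G := (fun p => K * (w * (expR (- (x * (t p * t p))) *
   expR (- (y * (s p * s p))) * expR (- (w * (t p * s p))) *
   exp_slope (2 * (w * (t p * s p)))))) @ F)).
  apply: near_eq_cvg; near=> p.
  have tp0 : t p != 0 by near: p.
  have sp0 : s p != 0 by near: p.
  rewrite /central_slope dotZl dotZr dotBl !dotBr !dot_line -/x -/y -/w.
  clearbody x y w.
  rewrite !sqrrN -!expr2 !mulrN !mulNr opprK -!mulrA.
  rewrite [expR (w * (t p * s p))]expR_odd; field.
  by rewrite tp0 sp0.
have -> : K * w = K * (w * (1 * 1 * 1 * 1)) by rewrite !mulr1.
apply: cvgMl_tmp; apply: cvgMl_tmp; apply: cvgM; last by apply: cvg_exp_slope; exact: cvg0Ml.
apply: cvgM; last by apply: cvg_expR; exact: cvg0N.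
by apply: cvgM; exact: cvg_expR.
Unshelve. all: by end_near. Qed.

Lemma cvg_dot_central_curvature c b :
  dot (central_curvature c (t p)) (central_curvature b (s p)) @[p --> F] -->
  K * (sigma ^+ 2 * (bform U c c * bform U b b + 2 * bform U c b ^+ 2)).
Proof.
set x := sigma * bform U c c; set y := sigma * bform U b b.
set w := 2 * sigma * bform U c b.
have ts0 : w * (t p * s p) @[p --> F] --> (0 : R) by apply/cvg0Ml/cvg0M.
have xt0 : - (x * (t p * t p)) @[p --> F] --> (0 : R) by apply/cvg0N/cvg0Ml/cvg0M.
have ys0 : - (y * (s p * s p)) @[p --> F] --> (0 : R) by apply/cvg0N/cvg0Ml/cvg0M.
have -> : sigma ^+ 2 * (bform U c c * bform U b b + 2 * bform U c b ^+ 2) =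
    x * y * (1 * 1) + w * w / 2 * (1 * 1 * 1 * (1 * 1)) by rewrite /x /y /w; field.
apply: (cvg_trans (G := (fun p => K * (
   x * y * (exp_slope (- (x * (t p * t p))) * exp_slope (- (y * (s p * s p))))
   + w * w / 2 * (expR (- (x * (t p * t p))) *
   expR (- (y * (s p * s p))) * expR (- (w * (t p * s p))) *
   (exp_slope (w * (t p * s p)) * exp_slope (w * (t p * s p)))))) @ F)).
  apply: near_eq_cvg; near=> p.
  have tp0 : t p != 0 by near: p.
  have sp0 : s p != 0 by near: p.
  rewrite /central_curvature dotZl dotZr !(dotBl, dotBr, dotDl, dotDr, dotZl, dotZr) //.
  rewrite ![dot (g (m + _)) (g m)]dotC !dot_line0 !dot_line dot_00 -/x -/y -/w.
  clearbody x y w.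
  rewrite !sqrrN -!expr2 !mulrN !mulNr opprK -!mulrA.
  rewrite [expR (w * (t p * s p))]expR_even !exp_slopeE.
  field.
  by rewrite tp0 sp0.
apply: cvgMl_tmp; apply: cvgD; apply: cvgMl_tmp.
  by apply: cvgM; exact: cvg_exp_slope.
apply: cvgM; last by apply: cvgM; exact: cvg_exp_slope.
apply: cvgM; last by apply: cvg_expR; exact: cvg0N.
by apply: cvgM; exact: cvg_expR.
Unshelve. all: by end_near. Qed.

Lemma cvg_dot0_central_curvature c :
  dot (g m) (central_curvature c (t p)) @[p --> F] --> K * - (sigma * bform U c c).
Proof.
set x := sigma * bform U c c.
have xt0 : - (x * (t p * t p)) @[p --> F] --> (0 : R) by apply/cvg0N/cvg0Ml/cvg0M.
have -> : K * - x = K * (- x * 1) by rewrite mulr1.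
apply: (cvg_trans (G :=
    (fun p => K * (- x * exp_slope (- (x * (t p * t p))))) @ F)).
  apply: near_eq_cvg; near=> p.
  have tp0 : t p != 0 by near: p.
  rewrite /central_curvature !(dotBr, dotDr, dotZr) !dot_line0 dot_00 -/x.
  clearbody x; rewrite !sqrrN -!expr2 exp_slopeE.
  by field.
by apply: cvgMl_tmp; apply: cvgMl_tmp; exact: cvg_exp_slope.
Unshelve. all: by end_near. Qed.

Let W := invmx (Vmx sigma S).

Lemma cvg_dot_central_slope_section c z :
  dot (central_slope c (t p)) (rkhs_section H z) @[p --> F] -->
  gauss_embedding sigma m S z * (2 * sigma * bform W (z - m) c).
Proof.
set x := sigma * bform W c c; set w := 2 * sigma * bform W (z - m) c.
have wt0 : w * t p @[p --> F] --> (0 : R) by apply/cvg0Ml.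
have xt0 : - (x * (t p * t p)) @[p --> F] --> (0 : R) by apply/cvg0N/cvg0Ml/cvg0M.
have -> : gauss_embedding sigma m S z * w =
  gauss_embedding sigma m S z * (w * (1 * 1 * 1)) by rewrite !mulr1.
apply: (cvg_trans (G := (fun p => gauss_embedding sigma m S z * (w * (
    expR (- (x * (t p * t p))) * expR (- (w * t p)) *
    exp_slope (2 * (w * t p))))) @ F)).
  apply: near_eq_cvg; near=> p.
  have tp0 : t p != 0 by near: p.
  rewrite /central_slope dotZl dotBl !dot_line_section -/x -/w; clearbody x w.
  rewrite !sqrrN -!expr2 !mulrN [expR (w * t p)]expR_odd; field.
  exact: tp0.
apply: cvgMl_tmp; apply: cvgMl_tmp; apply: cvgM.
  by apply: cvgM; apply: cvg_expR => //; exact: cvg0N.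
by apply: cvg_exp_slope; exact: cvg0Ml.
Unshelve. all: by end_near. Qed.

Lemma cvg_dot_central_curvature_section c z :
  dot (central_curvature c (t p)) (rkhs_section H z) @[p --> F] -->
  gauss_embedding sigma m S z *
    (2 * sigma ^+ 2 * bform W (z - m) c ^+ 2 - sigma * bform W c c).
Proof.
have -> : 2 * sigma ^+ 2 * bform W (z - m) c ^+ 2 =
    2 * sigma * bform W (z - m) c * (2 * sigma * bform W (z - m) c) / 2.
  by field.
set x := sigma * bform W c c; set w := 2 * sigma * bform W (z - m) c.
have wt0 : w * t p @[p --> F] --> (0 : R) by apply/cvg0Ml.
have xt0 : - (x * (t p * t p)) @[p --> F] --> (0 : R) by apply/cvg0N/cvg0Ml/cvg0M.
have -> : w * w / 2 - x = w * w / 2 * (1 * 1 * (1 * 1)) - x * 1.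
  by rewrite !mulr1.
apply: (cvg_trans (G := (fun p => gauss_embedding sigma m S z *
    (w * w / 2 * (expR (- (x * (t p * t p))) * expR (- (w * t p)) *
    (exp_slope (w * t p) * exp_slope (w * t p))) -
    x * exp_slope (- (x * (t p * t p))))) @ F)).
  apply: near_eq_cvg; near=> p.
  have tp0 : t p != 0 by near: p.
  rewrite /central_curvature dotZl dotBl dotDl dotZl !dot_line_section -/x -/w.
  rewrite (embeds_dot _ _ gE) -[gauss_profile _ _ _]/(gauss_embedding sigma m S z).
  clearbody x w.
  rewrite !sqrrN -!expr2 !mulrN [expR (w * t p)]expR_even !exp_slopeE; field.
  exact: tp0.
apply: cvgMl_tmp; apply: cvgB; apply: cvgMl_tmp; last exact: cvg_exp_slope.
apply: cvgM; last by apply: cvgM; exact: cvg_exp_slope.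
by apply: cvgM; apply: cvg_expR => //; exact: cvg0N.
Unshelve. all: by end_near. Qed.

End Limits.

Lemma dot0_central_slope c t : dot (g m) (central_slope c t) = 0.
Proof. by rewrite dotZr dotBr !dot_line0 sqrrN subrr mulr0. Qed.

Lemma dot_central_slope_central_curvature c b t s :
  dot (central_slope c t) (central_curvature b s) = 0.
Proof.
rewrite dotZl dotZr !(dotBl, dotBr, dotDl, dotDr, dotZl, dotZr).
rewrite ![dot (g (m + _)) (g m)]dotC !dot_line0 !dot_line !sqrrN !mulrN !mulNr.
by rewrite opprK; ring.
Qed.

(** The two filters used: nonzero steps, and pairs of nonzero steps. *)
Let punctured_filter : ProperFilter (0 : R)^'.
Proof. exact: Proper_dnbhs_numFieldType. Qed.

Let off_axes := filter_prod (0 : R)^' (0 : R)^'.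

Let off_axes_filter : ProperFilter off_axes.
Proof. exact: filter_prod_proper. Qed.

Let punctured : (0 : R)^' --> (0 : R).
Proof. exact: cvg_within. Qed.

Let fst0 : p.1 @[p --> ((0 : R)^', (0 : R)^')] --> (0 : R).
Proof. exact: (cvg_trans (cvg_fst (G := (0 : R)^')) punctured). Qed.

Let snd0 : p.2 @[p --> ((0 : R)^', (0 : R)^')] --> (0 : R).
Proof. exact: (cvg_trans (cvg_snd (F := (0 : R)^')) punctured). Qed.

Let punctured_neq : \forall t \near (0 : R)^', t != 0.
Proof. exact: nbhs_dnbhs_neq. Qed.

Let fst_neq : \forall p \near ((0 : R)^', (0 : R)^'), p.1 != 0.
Proof. exact: (cvg_fst punctured_neq). Qed.

Let snd_neq : \forall p \near ((0 : R)^', (0 : R)^'), p.2 != 0.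
Proof. exact: (cvg_snd punctured_neq). Qed.

Lemma cvg_central_slope c : cvg (central_slope c t @[t --> (0 : R)^']).
Proof.
have h := cvg_dot_central_slope (c := c) (b := c) off_axes_filter
  fst0 snd0 fst_neq snd_neq.
by have := cvg_gram dotE punctured_filter h; exact.
Qed.

Lemma cvg_central_curvature c : cvg (central_curvature c t @[t --> (0 : R)^']).
Proof.
have h := cvg_dot_central_curvature (c := c) (b := c) off_axes_filter
  fst0 snd0 fst_neq snd_neq.
by have := cvg_gram dotE punctured_filter h; exact.
Qed.

Definition deriv1 c : H := lim (central_slope c t @[t --> (0 : R)^']).
Definition deriv2 c : H := lim (central_curvature c t @[t --> (0 : R)^']).

Let dot_lim (a b : R -> H) (u v : H) l : a @ (0 : R)^' --> u -> b @ (0 : R)^' --> v ->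
  dot (a t) (b t) @[t --> (0 : R)^'] --> l -> dot u v = l.
Proof.
move=> au bv; apply: (cvg_unique (@Rhausdorff R)); exact: (cvg_dot dotE).
Qed.

Lemma dot_deriv1 c b : dot (deriv1 c) (deriv1 b) = K * (2 * sigma * bform U c b).
Proof.
apply: (dot_lim (@cvg_central_slope c) (@cvg_central_slope b)).
exact: (cvg_dot_central_slope (c := c) (b := b) _
  punctured punctured punctured_neq punctured_neq).
Qed.

Lemma dot_deriv2 c b : dot (deriv2 c) (deriv2 b) =
  K * (sigma ^+ 2 * (bform U c c * bform U b b + 2 * bform U c b ^+ 2)).
Proof.
apply: (dot_lim (@cvg_central_curvature c) (@cvg_central_curvature b)).
exact: (cvg_dot_central_curvature (c := c) (b := b) _
  punctured punctured punctured_neq punctured_neq).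
Qed.

Lemma dot_deriv1_deriv2 c b : dot (deriv1 c) (deriv2 b) = 0.
Proof.
apply: (dot_lim (@cvg_central_slope c) (@cvg_central_curvature b)).
under eq_cvg do rewrite dot_central_slope_central_curvature; exact: cvg_cst.
Qed.

Lemma dot0_deriv1 c : dot (g m) (deriv1 c) = 0.
Proof.
apply: (dot_lim (cvg_cst (g m)) (@cvg_central_slope c)).
under eq_cvg do rewrite dot0_central_slope; exact: cvg_cst.
Qed.

Lemma dot0_deriv2 c : dot (g m) (deriv2 c) = K * - (sigma * bform U c c).
Proof.
apply: (dot_lim (cvg_cst (g m)) (@cvg_central_curvature c)).
exact: (cvg_dot0_central_curvature (c := c) _ punctured punctured_neq).
Qed.

Lemma dot_deriv1_section c z : dot (deriv1 c) (rkhs_section H z) =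
  gauss_embedding sigma m S z *
    (2 * sigma * bform (invmx (Vmx sigma S)) (z - m) c).
Proof.
apply: (dot_lim (@cvg_central_slope c) (cvg_cst (rkhs_section H z))).
exact: (cvg_dot_central_slope_section (c := c) (z := z) _ punctured punctured_neq).
Qed.

Lemma dot_deriv2_section c z : dot (deriv2 c) (rkhs_section H z) =
  gauss_embedding sigma m S z *
    (2 * sigma ^+ 2 * bform (invmx (Vmx sigma S)) (z - m) c ^+ 2
     - sigma * bform (invmx (Vmx sigma S)) c c).
Proof.
apply: (dot_lim (@cvg_central_curvature c) (cvg_cst (rkhs_section H z))).
exact: (cvg_dot_central_curvature_section (c := c) (z := z) _ punctured punctured_neq).
Qed.

End Derivatives.

(** * The embedding plus its derivative in mean and covariance *)

Section Differential.
Context (R : realType) (d : nat) (sigma : R) (sigma_gt0 : 0 < sigma).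
Context (H : rkhs (@gauss_kernel R d sigma)).
Implicit Types (a b c u v z : 'cV[R]_d).
Notation dot := (rkhs_dot H).
Context (cs : seq 'cV[R]_d) (g : 'cV[R]_d -> H) (m : 'cV[R]_d).
Notation S := (outer_sum cs).
Context (gE : embeds S g) (gc : coherent S g).
Let cS : is_covariance S := outer_sum_covariance cs.
Let V := Vmx sigma S.
Let W := invmx V.
Let U := invmx (Vmx sigma (S + S)).
Let K := \det (Vmx sigma (S + S)) `^ (- 2^-1).
Notation deriv1 := (deriv1 g m).
Notation deriv2 := (deriv2 g m).

(** The derivative of the embedding in the covariance, in the direction
    a a^T - S with S = outer_sum cs. The direction a a^T need not lie in the
    range of S, so the term is built from derivatives in the mean, and not from
    a weight on the normal variable. *)
Definition covariance_term a : H := deriv2 a - \sum_(c <- cs) deriv2 c.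

(** Transfers a formula known on rank-one directions to a a^T - S by
    linearity. *)
Lemma dot_covariance_term h (Phi : 'M[R]_d -> R) :
  {morph Phi : A B / A - B} -> (forall c, dot h (deriv2 c) = Phi (c *m c^T)) ->
  forall a, dot h (covariance_term a) = Phi (a *m a^T - S).
Proof.
move=> PhiB hPhi a; rewrite /covariance_term /outer_sum.
elim: cs => [|c s IH]; first by rewrite !big_nil !subr0 hPhi.
by rewrite !big_cons ![_ + \sum_(_ <- _) _]addrC !opprD !addrA dotBr IH hPhi !PhiB.
Qed.

Definition linearized_embedding a : H := g m + deriv1 a + covariance_term a.

Lemma linearized_embedding_section a z : rkhs_eval H (linearized_embedding a) z =
  gauss_embedding sigma m S z
    * (1 + 2 * sigma * bform W (z - m) a
       + sigma * \tr (W *m ((2 * sigma) *: ((z - m) *m (z - m)^T *m W) - 1%:M)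
                        *m (a *m a^T - S))).
Proof.
have [sW _] := invVmx_covariance sigma_gt0 cS.
rewrite -rkhs_reproducing /linearized_embedding 2!dotDl (embeds_dot _ _ gE).
rewrite -[gauss_profile _ _ _]/(gauss_embedding sigma m S z).
rewrite (dot_deriv1_section sigma_gt0 m cS gE gc) [dot (covariance_term a) _]dotC.
set P := gauss_embedding _ _ _ _; set M := W *m _.
rewrite (dot_covariance_term (Phi := fun A => P * (sigma * \tr (M *m A)))).
- by rewrite /W /V; ring.
- by move=> A B; rewrite mulmxBr linearB /=; ring.
move=> c; rewrite dotC (dot_deriv2_section sigma_gt0 m cS gE gc) -/P -/V -/W; congr (P * _).
rewrite mxtrace_mulC tr_outer_mul /M mulmxBr mulmx1.
rewrite -scalemxAr bformDA bformZA bformNA.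
have -> : bform (W *m ((z - m) *m (z - m)^T *m W)) c c = bform W (z - m) c ^+ 2.
  transitivity (bform ((z - m) *m (z - m)^T) (W *m c) (W *m c)).
    by rewrite /bform trmx_mul sW !mulmxA.
  rewrite bform_outer /bform !mulmx1 trmx_mul sW.
  by rewrite -!/(bform _ _ _) (bformC c (z - m) sW) expr2 !mulmxA.
by ring.
Qed.

(** The second derivative of det^(-1/2), up to the factor K sigma^2. *)
Let pairing (A B : 'M[R]_d) : R :=
  \tr (A *m U) * \tr (B *m U) + 2 * \tr (A *m U *m B *m U).

Lemma pairing_outer b c : pairing (b *m b^T) (c *m c^T) =
  bform U b b * bform U c c + 2 * bform U b c ^+ 2.
Proof.
have [sU _] := invVmx_covariance sigma_gt0 (covarianceD cS cS).
rewrite /pairing !tr_outer_mul; congr (_ + 2 * _).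
have -> : b *m b^T *m U *m (c *m c^T) *m U =
    b *m b^T *m (U *m (c *m c^T) *m U) by rewrite !mulmxA.
rewrite tr_outer_mul.
transitivity (bform (c *m c^T) (U *m b) (U *m b)).
  by rewrite /bform trmx_mul sU !mulmxA.
rewrite bform_outer /bform !mulmx1 trmx_mul sU mulmxA.
by rewrite -!/(bform _ _ _) (bformC c b sU) expr2.
Qed.

Lemma pairingBl B : {morph pairing^~ B : A A' / A - A'}.
Proof. by move=> A A'; rewrite /pairing !mulmxBl !linearB /=; ring. Qed.

Lemma pairingBr A : {morph pairing A : B B' / B - B'}.
Proof.
by move=> B B'; rewrite /pairing !mulmxBr !mulmxBl !linearB /=; ring.
Qed.

Lemma dot_linearized_embedding a b :
  dot (linearized_embedding a) (linearized_embedding b) =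
  K * (1 + sigma * \tr ((2 *: (a *m b^T) - (a *m a^T - S) - (b *m b^T - S)) *m U)
       + sigma ^+ 2 * pairing (a *m a^T - S) (b *m b^T - S)).
Proof.
have [sU _] := invVmx_covariance sigma_gt0 (covarianceD cS cS).
have g_deriv2 c : dot (g m) (covariance_term c) = K * - (sigma * \tr ((c *m c^T - S) *m U)).
  rewrite (dot_covariance_term (Phi := fun A => K * - (sigma * \tr (A *m U))))//.
    by move=> A B; rewrite mulmxBl linearB /=; ring.
  by move=> e; rewrite (dot0_deriv2 sigma_gt0 m cS gE gc) tr_outer_mul.
have deriv1_deriv2 c e : dot (deriv1 c) (covariance_term e) = 0.
  rewrite (dot_covariance_term (Phi := fun=> 0))// => [_ _|e']; first by rewrite subrr.
  by rewrite (dot_deriv1_deriv2 sigma_gt0 m cS gE gc).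
have deriv2_deriv2 : dot (covariance_term a) (covariance_term b) =
    K * (sigma ^+ 2 * pairing (a *m a^T - S) (b *m b^T - S)).
  rewrite (dot_covariance_term (Phi := fun B => K * (sigma ^+ 2 * pairing (a *m a^T - S) B)))//.
    by move=> A B; rewrite pairingBr; ring.
  move=> c; rewrite dotC.
  rewrite (dot_covariance_term (Phi := fun A => K * (sigma ^+ 2 * pairing A (c *m c^T))))//.
    by move=> A B; rewrite pairingBl; ring.
  by move=> e; rewrite dotC (dot_deriv2 sigma_gt0 m cS gE gc) pairing_outer.
have dot_sum3 (u v w u' v' w' : H) : dot (u + v + w) (u' + v' + w') =
    dot u u' + dot u v' + dot u w' + (dot v u' + dot v v' + dot v w') +
    (dot w u' + dot w v' + dot w w') by rewrite !(dotDl, dotDr); ring.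
rewrite /linearized_embedding dot_sum3 [dot (deriv1 a) (g m)]dotC
  [dot (covariance_term a) (g m)]dotC [dot (covariance_term a) (deriv1 b)]dotC.
rewrite !g_deriv2 !deriv1_deriv2 deriv2_deriv2 !(dot0_deriv1 sigma_gt0 m cS gE gc).
rewrite (dot_00 sigma_gt0 m cS gE gc) (dot_deriv1 sigma_gt0 m cS gE gc) -/K -/U.
rewrite [in RHS]mulmxBl [in RHS]mulmxBl -scalemxAl !linearB /= mxtraceZ tr_outer_mul.
by rewrite (bformC b a sU); ring.
Qed.

End Differential.

(** * The inner product of two residuals *)

Theorem mainTheorem4 (R : realType) (d : nat) (sigma : R)
    (m0 : 'cV[R]_d) (Sigma0 : 'M[R]_d)
    (sigma_gt0 : 0 < sigma) (covSigma0 : is_covariance Sigma0)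
    (H : rkhs (@gauss_kernel R d sigma)) :
  let V := Vmx sigma Sigma0 in
  let B := Bmx m0 Sigma0 in
  let W := invmx V in
  let U := invmx (2 *: V - 1%:M) in
  exists f : 'cV[R]_d -> H,
    (forall x, rkhs_eval H (f x) = gauss_residual sigma m0 Sigma0 x) /\
    forall x y : 'cV[R]_d,
      rkhs_dot H (f x) (f y) =
        expR (- sigma * sqnorm2 (x - y))
      - \det V `^ (- 2^-1) * expR (- sigma * bform W (x - m0) (x - m0))
        * (1 + 2 * sigma * bform W (x - m0) (y - m0)
           + sigma * \tr (W *m ((2 * sigma) *: ((B x + Sigma0) *m W) - 1%:M)
                            *m B y))
      - \det V `^ (- 2^-1) * expR (- sigma * bform W (y - m0) (y - m0))
        * (1 + 2 * sigma * bform W (y - m0) (x - m0)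
           + sigma * \tr (W *m ((2 * sigma) *: ((B y + Sigma0) *m W) - 1%:M)
                            *m B x))
      + \det (2 *: V - 1%:M) `^ (- 2^-1)
        * (1 + sigma * \tr ((2 *: ((x - m0) *m (y - m0)^T) - B x - B y) *m U)
           + sigma ^+ 2 * (\tr (B x *m U) * \tr (B y *m U)
                           + 2 * \tr (B x *m U *m B y *m U))).
Proof.
(* f x is k(., x) minus the linearized embedding, so the inner product expands
   into four terms, three of which are evaluations by the reproducing
   property *)
have [cs S0E] := covariance_outer_sum covSigma0; subst Sigma0.
have [g gE gc] := gauss_embedding_in_rkhs sigma_gt0 H covSigma0.
move=> V B W U; have V2E : 2 *: V - 1%:M = Vmx sigma (outer_sum cs + outer_sum cs).
  by apply/matrixP => i j; rewrite /V /Vmx !mxE; ring.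
rewrite /U V2E /B /Bmx.
pose h x := linearized_embedding cs g m0 (x - m0).
have hE x z := linearized_embedding_section sigma_gt0 m0 gE gc (x - m0) z.
exists (fun x => rkhs_section H x - h x); split=> [x|x y].
  apply/funext => z; rewrite -rkhs_reproducing dotBl !rkhs_reproducing.
  by rewrite rkhs_sectionE hE.
rewrite dotBl !dotBr ![rkhs_dot H (rkhs_section H x) _]dotC.
rewrite !rkhs_reproducing rkhs_sectionE !hE (dot_linearized_embedding sigma_gt0 m0 gE gc).
rewrite !subrK /gauss_kernel /gauss_embedding -/V -/W.
set Tx := \tr (W *m _ *m _); set Ty := \tr (W *m _ *m _).
set Q := \det _ `^ _ * (_ + _ + _ * (_ + _)).
by ring.
Qed.
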